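(* Let $(A,B)$ be an infinitesimally rigid nonnegative rank-$r$ factorization, with $A\in\mathbb{R}^{m\times r}_{\ge 0}$ and $B\in\mathbb{R}^{r\times n}_{\ge 0}$, such that $A$ and $B$ have $r^2-r+1$ zero entries in total. Then there are at most $r-1$ zeros in every column of $A$ and at most $r-1$ zeros in every row of $B$.
   Context: Here $m,n,r$ are positive integers, and inequalities between matrices are entrywise. A nonnegative rank-$r$ factorization is a pair $(A,B)$ with $A\in\mathbb{R}^{m\times r}_{\ge 0}$, $B\in\mathbb{R}^{r\times n}_{\ge 0}$ and $\operatorname{rank}(AB)=r$. An infinitesimal motion of $(A,B)$ is a pair $(\dot A,\dot B)\in\mathbb{R}^{m\times r}\times\mathbb{R}^{r\times n}$ with $A\dot B+\dot A B=0$ such that for some $\epsilon>0$ one has $A+t\dot A\ge 0$ and $B+t\dot B\ge 0$ for all $t\in[0,\epsilon)$. The motion is trivial if $\dot A=AD$ and $\dot B=-DB$ for some diagonal $D\in\mathbb{R}^{r\times r}$. The factorization $(A,B)$ is infinitesimally rigid if all of its infinitesimal motions are trivial.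
   Formalization: The formal theorem assumes r ≥ 2; for r = 1 the claim fails, e.g. A = (0,1)^T, B = (1) is infinitesimally rigid with 1 = r^2-r+1 zero, but the column of A has one zero, more than r-1 = 0. *)

(* Defs.v *)
From HB Require Import structures.
From mathcomp Require Import all_boot all_order all_algebra.
From mathcomp Require Import reals.

Set Implicit Arguments.
Unset Strict Implicit.
Unset Printing Implicit Defensive.

Import Order.TTheory GRing.Theory Num.Theory.

Local Open Scope ring_scope.

Definition nonneg_factorization (R : realType) (m n r : nat)
    (A : 'M[R]_(m, r)) (B : 'M[R]_(r, n)) : Prop :=
  [/\ A \is a mxOver Num.nneg, B \is a mxOver Num.nneg & \rank (A *m B) = r].

Definition infinitesimal_motion (R : realType) (m n r : nat)
    (A : 'M[R]_(m, r)) (B : 'M[R]_(r, n))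
    (dA : 'M[R]_(m, r)) (dB : 'M[R]_(r, n)) : Prop :=
  A *m dB + dA *m B = 0 /\
  exists2 eps : R, 0 < eps &
    forall t : R, 0 <= t < eps ->
      (A + t *: dA \is a mxOver Num.nneg) /\
      (B + t *: dB \is a mxOver Num.nneg).

Definition trivial_motion (R : realType) (m n r : nat)
    (A : 'M[R]_(m, r)) (B : 'M[R]_(r, n))
    (dA : 'M[R]_(m, r)) (dB : 'M[R]_(r, n)) : Prop :=
  exists2 D : 'M[R]_r, is_diag_mx D & dA = A *m D /\ dB = - (D *m B).

Definition infinitesimally_rigid (R : realType) (m n r : nat)
    (A : 'M[R]_(m, r)) (B : 'M[R]_(r, n)) : Prop :=
  forall (dA : 'M[R]_(m, r)) (dB : 'M[R]_(r, n)),
    infinitesimal_motion A B dA dB -> trivial_motion A B dA dB.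

Definition num_zeros (R : realType) (p q : nat) (M : 'M[R]_(p, q)) : nat :=
  #|[set ij : 'I_p * 'I_q | M ij.1 ij.2 == 0]|.

(* Main.v *)
Require Import Defs.
From HB Require Import structures.
From mathcomp Require Import all_boot all_order all_algebra.
From mathcomp Require Import reals.
From mathcomp Require Import zify.

(** Right and left multiplication by a square matrix [D] turns [(A, B)] into the
    pair [(A D, - D B)], which always satisfies the bilinear equation
    [A dB + dA B = 0].  It is an infinitesimal motion as soon as it points
    inwards at the zero entries of [A] and [B], and, [B] having independent
    rows, it is trivial only if [D] is diagonal.  So rigidity says that every
    [D] subject to one linear inequality per zero entry is diagonal.

    Suppose that column [j] of [A] has at least [r] zeros.  The inequalities at
    these zeros involve only column [j] of [D], hence they all hold, as
    equalities, for the matrices [D] that vanish on the diagonal and on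
    column [j].  Such matrices form a space of dimension [(r - 1) ^ 2], which is
    positive because [r > 1], while at most
    [(r ^ 2 - r + 1) - r = (r - 1) ^ 2] inequalities remain.  In a nonzero space,
    no more homogeneous linear inequalities than the dimension always have a
    common nonzero solution ([exists_nonneg_combination]), and this solution
    contradicts rigidity.  The statement on the rows of [B] follows by
    transposing the factorization. *)

Set Implicit Arguments.
Unset Strict Implicit.
Unset Printing Implicit Defensive.

Import Order.TTheory GRing.Theory Num.Theory.

Local Open Scope ring_scope.

(** Either the rows of [W] are dependent, and a dependency makes all the
    inequalities equalities, or [W] is square and invertible, and every
    right-hand side, for instance a positive one, is reached. *)
Lemma exists_nonneg_mulmx (F : numFieldType) (d c : nat) (W : 'M[F]_(d, c)) :
  (0 < d)%N -> (c <= d)%N ->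
  exists2 u : 'rV[F]_d, u != 0 & forall k, 0 <= (u *m W) 0 k.
Proof.
move=> d_gt0 le_cd; have [freeW | ] := boolP (row_free W).
  have def_c : c = d.
    by apply/eqP; rewrite eqn_leq le_cd -(eqP freeW) rank_leq_col.
  have fullW : row_full W by rewrite /row_full (eqP freeW) def_c.
  have uW : const_mx 1 *m pinvmx W *m W = const_mx 1 :> 'rV_c.
    by apply: mulmxKpV; apply: submx_full.
  exists (const_mx 1 *m pinvmx W); last by move=> k; rewrite uW mxE ler01.
  have c_gt0 : (0 < c)%N by rewrite def_c.
  apply/eqP => u0; have /matrixP/(_ 0 (Ordinal c_gt0))/eqP := uW.
  by rewrite u0 mul0mx !mxE eq_sym oner_eq0.
rewrite -kermx_eq0 => /rowV0Pn[u /sub_kermxP uW0 u_neq0].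
by exists u => // k; rewrite uW0 mxE.
Qed.

Lemma exists_nonneg_combination (F : numFieldType) (I J : finType)
    (P : {set I}) (Q : {set J}) (W : I -> J -> F) :
  (0 < #|P|)%N -> (#|Q| <= #|P|)%N ->
  exists u : I -> F,
    [/\ exists i, u i != 0, forall i, i \notin P -> u i = 0
      & forall z, z \in Q -> 0 <= \sum_i u i * W i z].
Proof.
move=> P_gt0 leQP.
pose M := \matrix_(a < #|P|, b < #|Q|) W (enum_val a) (enum_val b).
have [v v_neq0 vM] := exists_nonneg_mulmx M P_gt0 leQP.
have /card_gt0P[i0 Pi0] := P_gt0.
pose u i := if i \in P then v 0 (enum_rank_in Pi0 i) else 0.
have uE a : u (enum_val a) = v 0 a by rewrite /u enum_valP enum_valK_in.
exists u; split.
- have /rV0Pn[a va] := v_neq0.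
  by exists (enum_val a); rewrite uE.
- by rewrite /u => i /negbTE->.
move=> z Qz; have := vM (enum_rank_in Qz z); rewrite mxE.
rewrite (bigID (mem P)) /= [X in _ -> 0 <= _ + X]big1 ?addr0; last first.
  by move=> i /negbTE iP; rewrite /u iP mul0r.
rewrite (big_enum_val (A := mem P)) /=; congr (_ <= _).
by apply: eq_bigr => a _; rewrite !mxE enum_rankK_in // uE.
Qed.

(** A zero entry only needs a nonnegative velocity; a positive entry [a] with
    velocity [v] stays nonnegative up to time [a / (1 + `|v|)].  The minimum of
    these finitely many times is a common bound. *)
Lemma mxOver_nneg_segment (R : realFieldType) (p q : nat) (M N : 'M[R]_(p, q)) :
  M \is a mxOver Num.nneg -> (forall i j, M i j = 0 -> 0 <= N i j) ->
  exists2 eps : R, 0 < eps &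
    forall t, 0 <= t < eps -> M + t *: N \is a mxOver Num.nneg.
Proof.
move=> /mxOverP M_ge0 N_ge0.
have M0 i j : 0 <= M i j by have := M_ge0 i j; rewrite nnegrE.
pose b (x : 'I_p * 'I_q) : R :=
  if M x.1 x.2 == 0 then 1 else M x.1 x.2 / (1 + `|N x.1 x.2|).
have den_gt0 i j : 0 < 1 + `|N i j| by rewrite ltr_wpDr ?ltr01.
exists (\big[Order.min/1]_x b x).
  apply/bigmin_gtP; split=> [|x _]; first exact: ltr01.
  rewrite /b; case: eqP => [_|/eqP Mx]; first exact: ltr01.
  by rewrite divr_gt0 // lt_def Mx M0.
move=> t /andP[t_ge0 t_lt]; apply/mxOverP => i j; rewrite nnegrE !mxE.
have /(lt_le_trans t_lt) : \big[Order.min/1]_x b x <= b (i, j).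
  exact: bigmin_le_cond.
rewrite /b /=; case: eqP => [Mij _ | _].
  by rewrite Mij add0r mulr_ge0 ?N_ge0.
rewrite ltr_pdivlMr // => lt_tM; rewrite -lerBlDl sub0r.
rewrite lerNl (le_trans _ (ltW lt_tM)) // -mulrN ler_wpM2l //.
by rewrite -normrN (le_trans (ler_norm _)) // lerDr.
Qed.

(** This replaces pairs of velocities by one square matrix: [(A D, - D B)] is
    then a motion, so [D B = D' B] for some diagonal [D'], and [B] can be
    cancelled because its rank is [r]. *)
Lemma rigid_multiplier_diag (R : realType) (m n r : nat)
    (A : 'M[R]_(m, r)) (B : 'M[R]_(r, n)) (D : 'M[R]_r) :
  nonneg_factorization A B -> infinitesimally_rigid A B ->
  (forall i j, A i j = 0 -> 0 <= (A *m D) i j) ->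
  (forall i j, B i j = 0 -> 0 <= (- (D *m B)) i j) ->
  is_diag_mx D.
Proof.
move=> [A_ge0 B_ge0 rankAB] rigidAB zeroA zeroB.
have [eA eA_gt0 segA] := mxOver_nneg_segment A_ge0 zeroA.
have [eB eB_gt0 segB] := mxOver_nneg_segment B_ge0 zeroB.
have [|D' diagD' [_ /oppr_inj eqDB]] := rigidAB (A *m D) (- (D *m B)).
  split; first by rewrite mulmxN mulmxA addNr.
  exists (Order.min eA eB); first by rewrite lt_min eA_gt0.
  move=> t /andP[t_ge0]; rewrite lt_min => /andP[ltA ltB].
  by split; [apply: segA | apply: segB]; rewrite t_ge0.
have freeB : row_free B.
  by rewrite /row_free eqn_leq rank_leq_row -{1}rankAB mxrankM_maxr.
by rewrite (row_free_inj freeB eqDB).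
Qed.

Lemma card_offdiag_offcol (r : nat) (j : 'I_r) :
  #|[set p : 'I_r * 'I_r | (p.2 != j) && (p.1 != p.2)]| = ((r - 1) * (r - 1))%N.
Proof.
have card_neq (k : 'I_r) : #|[pred l | l != k]| = (r - 1)%N.
  by have := cardC1 k; rewrite card_ord subn1.
rewrite -sum1_card.
rewrite (eq_bigl (fun p : 'I_r * 'I_r => (p.2 != j) && (p.1 != p.2))); last first.
  by move=> p; rewrite inE.
rewrite (reindex_inj (can_inj swap_pairK)) /=.
rewrite -(pair_big_dep (fun k => k != j) (fun k l => l != k) (fun _ _ => 1%N)) /=.
under eq_bigr => k _ do rewrite sum1_card card_neq.
by rewrite sum_nat_const card_neq.
Qed.

(** Restricting to the [D] that vanish on the diagonal and on column [j] costs
    only [r - 1] of the [r ^ 2 - r] off-diagonal dimensions, but discards all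
    the inequalities coming from column [j] of [A]; if there are [r] of them or
    more, those that remain are too few to force [D = 0]. *)
Lemma rigid_zeros_col (R : realType) (m n r : nat) (r_gt1 : (1 < r)%N)
    (A : 'M[R]_(m, r)) (B : 'M[R]_(r, n)) (j : 'I_r) :
  nonneg_factorization A B -> infinitesimally_rigid A B ->
  (num_zeros A + num_zeros B <= r ^ 2 - r + 1)%N ->
  (#|[set i : 'I_m | A i j == 0%R]| <= r - 1)%N.
Proof.
move=> factAB rigidAB le_zeros; rewrite leqNgt; apply/negP => many_zeros.
(* The positions where D may be nonzero. *)
pose P := [set p : 'I_r * 'I_r | (p.2 != j) && (p.1 != p.2)].
pose ZA := [set x : 'I_m * 'I_r | A x.1 x.2 == 0].
pose Zj := [set x : 'I_m * 'I_r | (A x.1 x.2 == 0) && (x.2 == j)].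
pose ZB := [set x : 'I_r * 'I_n | B x.1 x.2 == 0].
(* The inequalities that do not hold automatically for such a D. *)
pose Q := [set z : ('I_m * 'I_r) + ('I_r * 'I_n) |
  match z with inl x => x \in ZA :\: Zj | inr x => x \in ZB end].
have cardP : #|P| = ((r - 1) * (r - 1))%N := card_offdiag_offcol j.
have cardQ : #|Q| = (#|ZA :\: Zj| + #|ZB|)%N.
  rewrite -!sum1_card big_sumType /=.
  by congr (_ + _)%N; apply: eq_bigl => x; rewrite !inE.
have cardZj : #|Zj| = #|[set i : 'I_m | A i j == 0%R]|.
  rewrite -[RHS](card_imset _ (f := fun i => (i, j))); last by move=> i i' [].
  apply: eq_card => -[i k]; rewrite !inE /=; apply/andP/imsetP.
    by case=> Aik /eqP kj; exists i; rewrite ?inE -?kj.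
  by case=> i'; rewrite inE => Ai' [-> ->].
have ZjA : Zj \subset ZA by apply/subsetP=> x; rewrite !inE => /andP[].
have leQP : (#|Q| <= #|P|)%N.
  move: le_zeros many_zeros; rewrite cardQ cardP cardsDS // -cardZj.
  rewrite /num_zeros -/ZA -/ZB -mulnn; have := subset_leq_card ZjA.
  by nia.
have P_gt0 : (0 < #|P|)%N by rewrite cardP muln_gt0 subn_gt0 r_gt1.
(* The coefficient of the (p.1, p.2) entry of D in the inequality at z. *)
pose W (p : 'I_r * 'I_r) (z : ('I_m * 'I_r) + ('I_r * 'I_n)) : R :=
  match z with
  | inl x => A x.1 p.1 *+ (p.2 == x.2)
  | inr x => - (B p.2 x.2 *+ (p.1 == x.1))
  end.
have [u [[p up] uP uW]] := exists_nonneg_combination W P_gt0 leQP.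
pose D : 'M[R]_r := \matrix_(l, k) u (l, k).
have sumE z : \sum_q u q * W q z = \sum_l \sum_h u (l, h) * W (l, h) z.
  by rewrite pair_bigA; apply: eq_bigr => -[].
have ADE i k : (A *m D) i k = \sum_q u q * W q (inl (i, k)).
  rewrite mxE sumE; apply: eq_bigr => l _.
  rewrite (bigD1 k) //= big1 => [|h /negbTE hk].
    by rewrite eqxx mxE addr0 mulrC.
  by rewrite hk mulr0.
have DBE l i : (- (D *m B)) l i = \sum_q u q * W q (inr (l, i)).
  rewrite !mxE sumE [RHS](bigD1 l) //= [X in _ + X]big1 => [|g /negbTE gl].
    rewrite addr0 -sumrN; apply: eq_bigr => h _.
    by rewrite eqxx mxE mulrN.
  by rewrite big1 // => h _; rewrite gl oppr0 mulr0.
have diagD : is_diag_mx D.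
  apply: rigid_multiplier_diag factAB rigidAB _ _ => [i k Aik | l i Bli].
    have [-> | k_neq_j] := eqVneq k j.
      rewrite mxE big1 // => l _; rewrite mxE uP ?mulr0 //.
      by rewrite inE /= eqxx.
    by rewrite ADE uW // !inE /= Aik eqxx (negbTE k_neq_j).
  by rewrite DBE uW // !inE /= Bli.
have : p \in P by apply: contraNT up => /uP ->.
rewrite inE => /andP[_ off_diag].
have /is_diag_mxP/(_ p.1 p.2 off_diag) := diagD.
by rewrite mxE -surjective_pairing => /eqP; apply/negP.
Qed.

Lemma nonneg_factorization_tr (R : realType) (m n r : nat)
    (A : 'M[R]_(m, r)) (B : 'M[R]_(r, n)) :
  nonneg_factorization A B -> nonneg_factorization B^T A^T.
Proof.
move=> [/mxOverP A_ge0 /mxOverP B_ge0 rankAB]; split.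
- by apply/mxOverP => i j; rewrite mxE.
- by apply/mxOverP => i j; rewrite mxE.
- by rewrite -trmx_mul mxrank_tr.
Qed.

Lemma infinitesimally_rigid_tr (R : realType) (m n r : nat)
    (A : 'M[R]_(m, r)) (B : 'M[R]_(r, n)) :
  infinitesimally_rigid A B -> infinitesimally_rigid B^T A^T.
Proof.
move=> rigidAB dB dA [motion [eps eps_gt0 seg]].
have [|D /is_diag_mxP diagD [dAE dBE]] := rigidAB dA^T dB^T.
  split.
    by apply: trmx_inj; rewrite linearD /= !trmx_mul !trmxK trmx0 addrC.
  exists eps => // t /seg[/mxOverP segB /mxOverP segA].
  by split; apply/mxOverP => i j; [have := segA j i | have := segB j i];
    rewrite !mxE.
(* The factors swap, and so does the one that carries the minus sign. *)
exists (- D^T).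
  by apply/is_diag_mxP => i k ik; rewrite !mxE diagD 1?eq_sym ?oppr0.
rewrite -[dA]trmxK -[dB]trmxK dAE dBE linearN /= !trmx_mul.
by rewrite mulmxN mulNmx opprK.
Qed.

Lemma num_zeros_tr (R : realType) (p q : nat) (M : 'M[R]_(p, q)) :
  num_zeros M^T = num_zeros M.
Proof.
rewrite /num_zeros -[RHS](card_imset _ (can_inj swap_pairK)).
apply: eq_card => -[i j]; rewrite !inE mxE.
apply/idP/imsetP => [Mji | [[i' j']]]; first by exists (j, i); rewrite ?inE.
by rewrite inE => Mij [-> ->].
Qed.

(* The case r = 1 is excluded because the claim fails there: for
   A = (0, 1)^T and B = (1), the factorization is infinitesimally rigid and has
   1 = r^2 - r + 1 zero, yet the column of A has a zero. *)
Theorem lemma3p9 (R : realType) (m n r : nat)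
    (m_gt0 : (0 < m)%N) (n_gt0 : (0 < n)%N) (r_gt1 : (1 < r)%N)
    (A : 'M[R]_(m, r)) (B : 'M[R]_(r, n)) :
  nonneg_factorization A B ->
  infinitesimally_rigid A B ->
  (num_zeros A + num_zeros B = r ^ 2 - r + 1)%N ->
  (forall j : 'I_r, #|[set i : 'I_m | A i j == 0%R]| <= r - 1)%N /\
  (forall i : 'I_r, #|[set j : 'I_n | B i j == 0%R]| <= r - 1)%N.
Proof.
move=> factAB rigidAB zerosAB; split=> [j | i].
  by apply: rigid_zeros_col factAB rigidAB _; rewrite ?zerosAB.
have := rigid_zeros_col r_gt1 i (nonneg_factorization_tr factAB)
  (infinitesimally_rigid_tr rigidAB).
rewrite !num_zeros_tr addnC zerosAB => /(_ (leqnn _)).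
by congr (_ <= _)%N; apply: eq_card => j; rewrite !inE mxE.
Qed.
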